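(* Let $n\ge4$. For any $n$-gon $P$ in the plane $\mathbf A$, the corresponding Cayley-Menger frieze $\mathbf z_{\mathrm{CM}}(P)$ is coherent.
   Context: $\mathbf A=\mathbb C^2$; for points $A,B\in\mathbf A$, $x(A,B)=\langle\overrightarrow{AB},\overrightarrow{AB}\rangle$ where $\langle u,v\rangle=u'v'+u''v''$ (complex bilinear). An $n$-gon is an $n$-tuple $P=(A_1,\dots,A_n)\in\mathbf A^n$; $x_{ij}=x(A_i,A_j)$ (so $x_{ii}=0$). The Cayley-Menger polynomial is $$M(a,b,c,d,e,f)=\det\begin{bmatrix}0&1&1&1&1\\1&0&b&e&a\\1&b&0&c&f\\1&e&c&0&d\\1&a&f&d&0\end{bmatrix}.$$ A Cayley-Menger diamond is a 6-tuple $(a,b,c,d,e,f)\in\mathbb C^6$ with $M(a,b,c,d,e,f)=0$. Notation for partial derivatives: $\partial_\uparrow M=\partial M/\partial a$, $\partial_\downarrow M=\partial M/\partial c$, $\partial_\leftarrow M=\partial M/\partial e$, $\partial_\rightarrow M=\partial M/\partial f$. For $n\ge4$ let $L_n=\{(i+\frac12,/):i\in\mathbb Z\}\cup\{(\backslash,j+\frac12):j\in\mathbb Z\}$ (formal indices) and $I_n^{\mathrm{CM}}=\{(i,j)\in\mathbb Z^2:0\le j-i\le n\}\cup L_n$. For an array $\mathbf z=(z_\alpha)_{\alpha\in I_n^{\mathrm{CM}}}$ of complex numbers and $(i,j)\in\mathbb Z^2$ with $1\le j-i\le n-1$ put $$\Diamond_{i,j}(\mathbf z)=(z_{(i,j+1)},z_{(i+\frac12,/)},z_{(i+1,j)},z_{(\backslash,j+\frac12)},z_{(i,j)},z_{(i+1,j+1)}).$$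 A Cayley-Menger frieze of order $n$ is such an array in which every $\Diamond_{i,j}(\mathbf z)$, $1\le j-i\le n-1$, is a Cayley-Menger diamond and, for all $i\in\mathbb Z$: $z_{(i,i)}=0$, $z_{(i,i+1)}=z_{(i+\frac12,/)}=z_{(\backslash,i+\frac12)}$, $z_{(i,i+n)}=0$, $z_{(i,i+n-1)}=z_{(i-\frac12,/)}=z_{(\backslash,i+n-\frac12)}$. It is coherent if for all $(i,j)\in\mathbb Z^2$ with $2\le j-i\le n-2$ $$\partial_\leftarrow M(\Diamond_{i-1,j-1}(\mathbf z))\,\partial_\rightarrow M(\Diamond_{i,j}(\mathbf z))=\partial_\uparrow M(\Diamond_{i-1,j}(\mathbf z))\,\partial_\downarrow M(\Diamond_{i,j-1}(\mathbf z)).$$ The Cayley-Menger frieze $\mathbf z_{\mathrm{CM}}(P)$ of an $n$-gon $P$ is defined by $z_{(i,j)}=x_{\langle i\rangle\langle j\rangle}$, $z_{(i+\frac12,/)}=x_{\langle i\rangle\langle i+1\rangle}$, $z_{(\backslash,j+\frac12)}=x_{\langle j\rangle\langle j+1\rangle}$, where $\langle m\rangle\in\{1,\dots,n\}$ is the residue of $m$ mod $n$. *)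

(* Defs.v *)
From mathcomp Require Import all_boot all_order all_algebra.
From mathcomp Require Import reals complex mpoly.

Set Implicit Arguments.
Unset Strict Implicit.
Unset Printing Implicit Defensive.

Import Order.TTheory GRing.Theory Num.Theory.
Local Open Scope ring_scope.

(* The complex numbers are R[i] for an arbitrary R : realType. *)

Section CayleyMenger.
Variable R : realType.
Local Notation C := R[i].

Definition point : Type := 'rV[C]_2.

(* Bilinear, without complex conjugation. *)
Definition cdot (u v : 'rV[C]_2) : C := u 0 0 * v 0 0 + u 0 1 * v 0 1.

Definition sqdist (A B : point) : C := cdot (B - A) (B - A).

(* The variables a, b, c, d, e, f of M, in this order. *)
Definition ia : 'I_6 := @Ordinal 6 0 isT.
Definition ib : 'I_6 := @Ordinal 6 1 isT.
Definition ic : 'I_6 := @Ordinal 6 2 isT.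
Definition id_ : 'I_6 := @Ordinal 6 3 isT.
Definition ie : 'I_6 := @Ordinal 6 4 isT.
Definition if_ : 'I_6 := @Ordinal 6 5 isT.

Definition cm_rows : seq (seq {mpoly C[6]}) :=
  let a := 'X_ia in let b := 'X_ib in let c := 'X_ic in
  let d := 'X_id_ in let e := 'X_ie in let f := 'X_if_ in
  [:: [:: 0; 1; 1; 1; 1];
      [:: 1; 0; b; e; a];
      [:: 1; b; 0; c; f];
      [:: 1; e; c; 0; d];
      [:: 1; a; f; d; 0]].

Definition cm_mx : 'M[{mpoly C[6]}]_5 :=
  \matrix_(i, j) nth 0 (nth [::] cm_rows i) j.

Definition cm_poly : {mpoly C[6]} := \det cm_mx.

Definition is_cm_diamond (t : 6.-tuple C) : Prop := cm_poly.@[tnth t] = 0.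

Definition dM_up    (t : 6.-tuple C) : C := (mderiv ia cm_poly).@[tnth t].
Definition dM_down  (t : 6.-tuple C) : C := (mderiv ic cm_poly).@[tnth t].
Definition dM_left  (t : 6.-tuple C) : C := (mderiv ie cm_poly).@[tnth t].
Definition dM_right (t : 6.-tuple C) : C := (mderiv if_ cm_poly).@[tnth t].

(* Node i j is (i, j), Slash i is (i + 1/2, /) and Bslash j is
   (\, j + 1/2).  An array of order n is a function on all of cm_index; its
   values at Node i j are only ever used for 0 <= j - i <= n. *)
Inductive cm_index : Type :=
  | Node of int & int
  | Slash of int
  | Bslash of int.

Definition cm_array : Type := cm_index -> C.

Definition diamond (z : cm_array) (i j : int) : 6.-tuple C :=
  [tuple z (Node i (j + 1)); z (Slash i); z (Node (i + 1) j);
         z (Bslash j); z (Node i j); z (Node (i + 1) (j + 1))].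

Record cm_frieze (n : nat) (z : cm_array) : Prop := CMFrieze {
  cm_frieze_diamond : forall i j : int,
    1 <= j - i <= n%:Z - 1 -> is_cm_diamond (diamond z i j);
  cm_frieze_diag0 : forall i : int, z (Node i i) = 0;
  cm_frieze_lower_slash : forall i : int, z (Node i (i + 1)) = z (Slash i);
  cm_frieze_lower_bslash : forall i : int, z (Slash i) = z (Bslash i);
  cm_frieze_diagn : forall i : int, z (Node i (i + n%:Z)) = 0;
  cm_frieze_upper_slash : forall i : int,
    z (Node i (i + n%:Z - 1)) = z (Slash (i - 1));
  cm_frieze_upper_bslash : forall i : int,
    z (Slash (i - 1)) = z (Bslash (i + n%:Z - 1))
}.

Definition coherent_eqs (n : nat) (z : cm_array) : Prop :=
  forall i j : int, 2 <= j - i <= n%:Z - 2 ->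
    dM_left (diamond z (i - 1) (j - 1)) * dM_right (diamond z i j)
    = dM_up (diamond z (i - 1) j) * dM_down (diamond z i (j - 1)).

Definition coherent_cm_frieze (n : nat) (z : cm_array) : Prop :=
  cm_frieze n z /\ coherent_eqs n z.

(* The representative of m modulo n in {1, ..., n}. *)
Definition residue (n : nat) (m : int) : nat :=
  `|((m - 1) %% n%:Z)%Z|%N.+1.

(* The vertices A_1, ..., A_n are stored at positions 0, ..., n - 1. *)
Definition vertex (n : nat) (P : n.-tuple point) (k : nat) : point :=
  nth 0 P k.-1.

Definition xdist (n : nat) (P : n.-tuple point) (i j : int) : C :=
  sqdist (vertex P (residue n i)) (vertex P (residue n j)).

Definition z_CM (n : nat) (P : n.-tuple point) : cm_array :=
  fun alpha => match alpha with
  | Node i j => xdist P i j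
  | Slash i => xdist P i (i + 1)
  | Bslash j => xdist P j (j + 1)
  end.

End CayleyMenger.

(* Main.v *)
(* Four points of the plane have vanishing Cayley-Menger determinant M, and the
   partial derivative of M with respect to the squared distance of two of them,
   X and Y, is 8 [XUV] [YUV], where U and V are the other two points and [.]
   is twice the signed area; relabelling the points reduces the four
   partial derivatives to one.  Writing X, X', Y, Y' for A_(i-1), A_(i+1),
   A_(j-1), A_(j+1), and [Z] for [Z A_i A_j], both sides of the coherence
   equation are 64 [X] [Y] [X'] [Y']. *)

Require Import Defs.
From mathcomp Require Import all_boot all_order all_algebra.
From mathcomp Require Import reals complex mpoly.
From mathcomp Require Import ring.

Set Implicit Arguments.
Unset Strict Implicit.
Unset Printing Implicit Defensive.

Import GRing.Theory.
Local Open Scope ring_scope.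

(* Indexing entries by nat and summing with foldr lets simplification expand
   a determinant of concrete size. *)
Fixpoint laplace_det (K : pzRingType) (n : nat) (F : nat -> nat -> K) : K :=
  if n is m.+1 then
    foldr (fun j s =>
      F 0%N j * ((-1) ^+ j * laplace_det m (fun i k => F i.+1 (bump j k))) + s)
      0 (iota 0 n)
  else 1.

Lemma det_laplace (K : comPzRingType) (n : nat) (F : nat -> nat -> K) :
  \det (\matrix_(i < n, j < n) F i j) = laplace_det n F.
Proof.
elim: n F => [|n IHn] F; first by rewrite det_mx00.
rewrite (expand_det_row _ ord0).
transitivity (\sum_(0 <= j < n.+1) F 0%N j *
      ((-1) ^+ j * laplace_det n (fun i k => F i.+1 (bump j k)))); last first.
  (* Unlocking the big sum exposes the [foldr] over [iota] of [laplace_det]. *)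
  by rewrite unlock.
rewrite big_mkord; apply: eq_bigr => j _; rewrite mxE /cofactor -IHn add0n.
by congr (_ * (_ * \det _)); apply/matrixP => i k; rewrite !mxE.
Qed.

(** The expanded determinant of a tetrahedron: [b * d], [e * f] and [a * c] pair opposite edges, and
    the four subtracted monomials are its faces. *)
Definition cm_form (K : pzRingType) (a b c d e f : K) : K :=
  (b * d * (e + f + a + c - b - d) + e * f * (b + d + a + c - e - f)
   + a * c * (b + d + e + f - a - c)
   - b * c * e - a * b * f - a * d * e - c * d * f) *+ 2.

Lemma det_cm (K : comPzRingType) (a b c d e f : K) :
  \det (\matrix_(i < 5, j < 5) nth 0 (nth [::]
    [:: [:: 0; 1; 1; 1; 1];
        [:: 1; 0; b; e; a];
        [:: 1; b; 0; c; f];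
        [:: 1; e; c; 0; d];
        [:: 1; a; f; d; 0]] i) j) =
  cm_form a b c d e f.
Proof.
rewrite (det_laplace 5 (fun i j => nth 0 (nth _ _ i) j)) /cm_form /=.
ring.
Qed.

Lemma cm_form_swap12_34 (K : comPzRingType) (a b c d e f : K) :
  cm_form a b c d e f = cm_form c b a d f e.
Proof. by rewrite /cm_form; ring. Qed.

Lemma cm_form_swap34 (K : comPzRingType) (a b c d e f : K) :
  cm_form a b c d e f = cm_form e b f d a c.
Proof. by rewrite /cm_form; ring. Qed.

(* The partial derivative of cm_form with respect to a. *)
Definition dcm_form (K : pzRingType) (a b c d e f : K) : K :=
  (b * d + e * f + c * (b + d + e + f - c) - a * c *+ 2 - b * f - d * e) *+ 2.

Lemma mderiv_Xi (K : comNzRingType) (n : nat) (i j : 'I_n) :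
  mderiv i ('X_j : {mpoly K[n]}) = (i == j)%:R.
Proof.
rewrite mderivX mnm1E eq_sym; case: eqVneq => [->|_]; last by rewrite scale0r.
by rewrite scale1r -{1}(add0m U_(j)%MM) addmK mpolyX0.
Qed.

Section MDerivCM.
Variables (K : comNzRingType) (n : nat).
Implicit Types (i : 'I_n) (a b c d e f : {mpoly K[n]}) (v : 'I_n -> K).

(** Stated for arbitrary polynomials so that it applies once a relabelling has moved the
    differentiated variable into the first slot. *)
Lemma mderiv_cm_form i a b c d e f :
    mderiv i a = 1 -> mderiv i b = 0 -> mderiv i c = 0 ->
    mderiv i d = 0 -> mderiv i e = 0 -> mderiv i f = 0 ->
  mderiv i (cm_form a b c d e f) = dcm_form a b c d e f.
Proof.
move=> da db dc dd de df; rewrite /cm_form /dcm_form.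
rewrite !(mderivMn, mderivB, mderivD, mderivM) da db dc dd de df.
ring.
Qed.

Lemma meval_cm_form v a b c d e f :
  (cm_form a b c d e f).@[v] =
  cm_form a.@[v] b.@[v] c.@[v] d.@[v] e.@[v] f.@[v].
Proof. by rewrite /cm_form !(mevalMn, mevalB, mevalD, mevalM). Qed.

Lemma meval_dcm_form v a b c d e f :
  (dcm_form a b c d e f).@[v] =
  dcm_form a.@[v] b.@[v] c.@[v] d.@[v] e.@[v] f.@[v].
Proof. by rewrite /dcm_form !(mevalMn, mevalB, mevalD, mevalM). Qed.

End MDerivCM.

Section Planar.
Variable R : realType.
Local Notation C := R[i].
Implicit Types A B D E : point R.

(* Twice the signed area of the triangle A B D. *)
Definition area2 A B D : C :=
  (B 0 0 - A 0 0) * (D 0 1 - A 0 1) - (B 0 1 - A 0 1) * (D 0 0 - A 0 0).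

Definition quad_diamond A B D E : 6.-tuple C :=
  [tuple sqdist A E; sqdist A B; sqdist B D; sqdist D E; sqdist A D;
         sqdist B E].

Lemma cm_polyE : cm_poly R = cm_form 'X_ia 'X_ib 'X_ic 'X_id_ 'X_ie 'X_if_.
Proof. exact: det_cm. Qed.

Lemma sqdistC A B : sqdist A B = sqdist B A.
Proof. by rewrite /sqdist /cdot !mxE; ring. Qed.

Lemma sqdistxx A : sqdist A A = 0.
Proof. by rewrite /sqdist /cdot !mxE; ring. Qed.

Lemma is_cm_diamond_quad A B D E : is_cm_diamond (quad_diamond A B D E).
Proof.
rewrite /is_cm_diamond cm_polyE meval_cm_form !mevalXU !(tnth_nth 0) /=.
rewrite /cm_form /sqdist /cdot !mxE.
ring.
Qed.

(** The derivative of the symmetric determinant is twice a cofactor, up to sign the mixed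
    Cayley-Menger determinant of the triangles [A B D] and [E B D], hence a multiple of the product
    of their areas. *)
Lemma dcm_form_sqdist A B D E :
  dcm_form (sqdist A E) (sqdist A B) (sqdist B D)
           (sqdist D E) (sqdist A D) (sqdist B E) =
  (area2 A B D * area2 E B D) *+ 8.
Proof.
rewrite /dcm_form /area2 /sqdist /cdot !mxE.
ring.
Qed.

Lemma dM_upE A B D E :
  dM_up (quad_diamond A B D E) = (area2 A B D * area2 E B D) *+ 8.
Proof.
rewrite -dcm_form_sqdist /dM_up cm_polyE.
by rewrite mderiv_cm_form ?mderiv_Xi // meval_dcm_form !mevalXU !(tnth_nth 0).
Qed.

Lemma dM_downE A B D E :
  dM_down (quad_diamond A B D E) = (area2 B A E * area2 D A E) *+ 8.
Proof.
rewrite -dcm_form_sqdist /dM_down cm_polyE cm_form_swap12_34.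
rewrite mderiv_cm_form ?mderiv_Xi // meval_dcm_form !mevalXU !(tnth_nth 0) /=.
by rewrite (sqdistC A B) (sqdistC D E).
Qed.

Lemma dM_leftE A B D E :
  dM_left (quad_diamond A B D E) = (area2 A B E * area2 D B E) *+ 8.
Proof.
rewrite -dcm_form_sqdist /dM_left cm_polyE cm_form_swap34.
rewrite mderiv_cm_form ?mderiv_Xi // meval_dcm_form !mevalXU !(tnth_nth 0) /=.
by rewrite (sqdistC D E).
Qed.

Lemma dM_rightE A B D E :
  dM_right (quad_diamond A B D E) = (area2 B A D * area2 E A D) *+ 8.
Proof.
(* The two relabellings compose to the exchange of [A] and [B] alone, which brings [f] to the
   front. *)
rewrite -dcm_form_sqdist /dM_right cm_polyE cm_form_swap12_34 cm_form_swap34.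
rewrite mderiv_cm_form ?mderiv_Xi // meval_dcm_form !mevalXU !(tnth_nth 0) /=.
by rewrite (sqdistC A B).
Qed.

(** Every area factor ends in [A B] in this order, so no signs arise and the two sides differ only
    by regrouping. *)
Lemma quad_diamond_coherent A' A A'' B' B B'' :
  dM_left (quad_diamond A' A B' B) * dM_right (quad_diamond A A'' B B'') =
  dM_up (quad_diamond A' A B B'') * dM_down (quad_diamond A A'' B' B).
Proof. by rewrite dM_leftE dM_rightE dM_upE dM_downE; ring. Qed.

End Planar.

Lemma residue_addn n (i : int) : residue n (i + n%:Z) = residue n i.
Proof. by rewrite /residue addrAC modzDr. Qed.

Theorem theorem5p12 (R : realType) (n : nat) (hn : (4 <= n)%N)
  (P : n.-tuple (point R)) : coherent_cm_frieze n (z_CM P).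
Proof.
pose v i := vertex P (residue n i).
have diamondE i j :
    diamond (z_CM P) i j = quad_diamond (v i) (v (i + 1)) (v j) (v (j + 1)).
  by [].
have vDn i : v (i + n%:Z) = v i by rewrite /v residue_addn.
have vDnB1 i : v (i + n%:Z - 1) = v (i - 1) by rewrite addrAC vDn.
split; first split=> i; rewrite /= /xdist -!/(v _).
- by move=> j _; rewrite diamondE; apply: is_cm_diamond_quad.
- exact: sqdistxx.
- by [].
- by [].
- by rewrite vDn sqdistxx.
- by rewrite vDnB1 subrK sqdistC.
- by rewrite vDnB1 !subrK vDn.
(* Cancelling [- 1 + 1] makes [v i] and [v j] the vertices common to all four diamonds. *)
move=> i j _; rewrite !diamondE !subrK; exact: quad_diamond_coherent.
Qed.
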